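(* Let $\mathfrak g_{d}$ be an $n$-dyon and $\mathfrak g_{t}$ an $n$-triadon on the same $n$-dimensional vector space $V$. Let $C_{d},C_{t}$ be their centers, $\Delta=[\mathfrak g_{d},\mathfrak g_{d}]$ the derived algebra of the dyon, $C_{12}=C_{d}\cap C_{t}$ and $C=C_{d}+C_{t}$. If $\dim C_{12}=n-3$ and $\Delta\cap C=\{0\}$, then $\mathfrak g_{d}$ and $\mathfrak g_{t}$ are incompatible.
   Context: The ground field $\mathbf k$ has characteristic zero. An $n$-dyon is a Lie algebra structure on an $n$-dimensional vector space isomorphic to the direct sum of the non-abelian $2$-dimensional Lie algebra and the $(n-2)$-dimensional abelian Lie algebra. An $n$-triadon is one isomorphic to the direct sum of the $3$-dimensional Heisenberg algebra ($[\varepsilon_1,\varepsilon_2]=\varepsilon_3$, $\varepsilon_3$ central) and the $(n-3)$-dimensional abelian Lie algebra. Two Lie algebra structures on $V$ are compatible if the sum of their brackets is a Lie bracket, and incompatible otherwise. *)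

(* Defs.v *)
From HB Require Import structures.
From mathcomp Require Import all_boot all_order all_algebra.

Set Implicit Arguments.
Unset Strict Implicit.
Unset Printing Implicit Defensive.

Import GRing.Theory.
Local Open Scope ring_scope.

(* A bracket is a bare function, so that the sum of two Lie brackets can be
   formed before it is known whether it is one. *)
Record is_lie_bracket (k : fieldType) (V : vectType k) (br : V -> V -> V)
    : Prop := IsLieBracket {
  lie_linear_l : forall y, linear (br^~ y);
  lie_linear_r : forall x, linear (br x);
  lie_alt : forall x, br x x = 0;
  lie_jacobi : forall x y z, br (br x y) z + br (br y z) x + br (br z x) y = 0
}.

Definition abelian_bracket (k : fieldType) (V : vectType k) : V -> V -> V :=
  fun _ _ => 0.

Definition dsum_bracket (k : fieldType) (V W : vectType k)
    (br : V -> V -> V) (br' : W -> W -> W) :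
    (V * W)%type -> (V * W)%type -> (V * W)%type :=
  fun p q => (br p.1 q.1, br' p.2 q.2).

Definition lie_isomorphic (k : fieldType) (V W : vectType k)
    (br : V -> V -> V) (br' : W -> W -> W) : Prop :=
  exists f : {linear V -> W},
    bijective f /\ forall x y, f (br x y) = br' (f x) (f y).

(* On row vectors, with eps_1, eps_2, eps_3 the standard basis of k^3 (indexed
   by 0, 1, ord_max): the alternating bilinear extension of
   [eps_1, eps_2] = eps_3, with eps_3 central. *)
Definition heisenberg_bracket (k : fieldType) (x y : 'rV[k]_3) : 'rV[k]_3 :=
  (x 0 0 * y 0 1 - x 0 1 * y 0 0) *: delta_mx 0 ord_max.

(* The non-abelian 2-dimensional Lie algebra is unique up to isomorphism, so
   any one on k^2 is allowed.  If n < 2 (n < 3 for triadons), truncated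
   subtraction is harmless: the condition on \dim V excludes the isomorphism. *)
Definition is_dyon (k : fieldType) (V : vectType k) (n : nat)
    (br : V -> V -> V) : Prop :=
  [/\ \dim {:V} = n, is_lie_bracket br &
    exists b : 'rV[k]_2 -> 'rV[k]_2 -> 'rV[k]_2,
      [/\ is_lie_bracket b, ~ (forall x y, b x y = 0) &
        lie_isomorphic br
          (dsum_bracket b (@abelian_bracket k 'rV[k]_(n - 2)))]].

Definition is_triadon (k : fieldType) (V : vectType k) (n : nat)
    (br : V -> V -> V) : Prop :=
  [/\ \dim {:V} = n, is_lie_bracket br &
    lie_isomorphic br
      (dsum_bracket (@heisenberg_bracket k)
         (@abelian_bracket k 'rV[k]_(n - 3)))].

(* Kernel of the adjoint map x |-> [x, -]; [linfun] is meaningful because a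
   Lie bracket is bilinear, see [lie_centerP]. *)
Definition lie_center (k : fieldType) (V : vectType k) (br : V -> V -> V)
    : {vspace V} :=
  lker (linfun (fun x => linfun (br x))).

(* Brackets of basis vectors suffice by bilinearity, see [lie_derivedP]. *)
Definition lie_derived (k : fieldType) (V : vectType k) (br : V -> V -> V)
    : {vspace V} :=
  <<[seq br x y | x <- vbasis {:V}, y <- vbasis {:V}]>>%VS.

Definition compatible (k : fieldType) (V : vectType k)
    (br br' : V -> V -> V) : Prop :=
  is_lie_bracket (fun x y => br x y + br' x y).

Definition incompatible (k : fieldType) (V : vectType k)
    (br br' : V -> V -> V) : Prop := ~ compatible br br'.

Section Sanity.
Variables (k : fieldType) (V : vectType k).

Let lin_of (W U : vectType k) (f : W -> U) (Hf : linear f) :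
  exists g : {linear W -> U}, g =1 f.
Proof.
pose m := GRing.isLinear.Build k W U *:%R f Hf.
pose g : {linear W -> U} := HB.pack f m.
by exists g.
Qed.

Let linfunE (W U : vectType k) (f : W -> U) :
  linear f -> linfun f =1 f.
Proof.
move=> Hf x; pose m := GRing.isLinear.Build k W U *:%R f Hf.
pose g : {linear W -> U} := HB.pack f m.
exact: (lfunE g x).
Qed.

Lemma lie_centerP (br : V -> V -> V) (x : V) : is_lie_bracket br ->
  reflect (forall y, br x y = 0) (x \in lie_center br).
Proof.
case=> linl linr _ _.
have linad : linear (fun x => linfun (br x)).
  move=> a u v; apply/lfunP => y.
  by rewrite add_lfunE scale_lfunE !linfunE // (linl y a u v).
rewrite memv_ker (linfunE linad).
apply: (iffP eqP) => [E y | E].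
  by rewrite -(linfunE (linr x)) E zero_lfunE.
by apply/lfunP => y; rewrite linfunE // E zero_lfunE.
Qed.

Lemma lie_derivedP (br : V -> V -> V) (U : {vspace V}) : is_lie_bracket br ->
  reflect (forall x y, br x y \in U) (lie_derived br <= U)%VS.
Proof.
case=> linl linr _ _; apply: (iffP span_subvP) => [H x y | H v]; last first.
  by case/allpairsP => p [_ _ ->].
have [g Eg] := lin_of (linr x).
rewrite (coord_vbasis (memvf y)) -Eg linear_sum rpred_sum // => j _.
rewrite linearZ rpredZ // Eg.
have [h Eh] := lin_of (linl (vbasis {:V})`_j).
rewrite (coord_vbasis (memvf x)) -[br _ _]Eh linear_sum rpred_sum // => i _.
rewrite linearZ rpredZ // Eh; apply: H; apply: allpairs_f.
  by rewrite mem_nth ?size_tuple.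
by rewrite mem_nth ?size_tuple.
Qed.

Lemma heisenberg_is_lie_bracket : is_lie_bracket (@heisenberg_bracket k).
Proof.
split=> [y a u v | x a u v | x | x y z]; rewrite /heisenberg_bracket.
- rewrite !mxE scalerA -scalerDl; congr (_ *: _).
  by rewrite !mulrDl opprD mulrDr mulrN !mulrA addrACA.
- rewrite !mxE scalerA -scalerDl; congr (_ *: _).
  rewrite !mulrDr opprD mulrN addrACA.
  by rewrite !mulrA ![_ * a]mulrC.
- by rewrite [x 0 1 * _]mulrC subrr scale0r.
- by rewrite !mxE /= !(mulr0, mul0r, subrr, scale0r, addr0).
Qed.

Lemma heisenberg_12 :
  heisenberg_bracket (delta_mx 0 0) (delta_mx 0 1) = delta_mx 0 ord_max
    :> 'rV[k]_3.
Proof.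
by rewrite /heisenberg_bracket !mxE /= !(mulr1, mul0r, subr0, scale1r).
Qed.

Lemma heisenberg_3 (x : 'rV[k]_3) :
  heisenberg_bracket (delta_mx 0 ord_max) x = 0.
Proof. by rewrite /heisenberg_bracket !mxE /= !mul0r subr0 scale0r. Qed.

End Sanity.

(* Main.v *)
Require Import Defs.
From mathcomp Require Import all_boot all_order all_algebra.
From mathcomp Require Import zify.

Set Implicit Arguments.
Unset Strict Implicit.
Unset Printing Implicit Defensive.

Import GRing.Theory.
Local Open Scope ring_scope.

(** The proof tests the Jacobi identity of the sum on triples [a], [b], [z]
    where [delta := gd a b] is nonzero and [z] lies in the center of the dyon
    [gd].  Only the mixed terms of the identity survive subtracting the Jacobi
    identities of [gd] and [gt] ([mixed_jacobi]), and those with [z] inside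
    [gd] vanish, leaving
      [gt delta z + gd (gt b z) a + gd (gt z a) b = 0].
    The last two terms lie in Delta.  The triadon [gt] is 2-step nilpotent
    ([triadon_nilpotent]), so the first one lies in its center, hence in the
    sum [C] of both centers.  As Delta and [C] meet trivially, [gt delta z = 0].
    Thus [gt delta] kills the center of [gd]; it also kills the center of [gt]
    and [delta] itself.

    These span [V]: each center has codimension at most 2, because each bracket
    factors through a plane, and the centers meet in codimension 3, so [C] is
    at least a hyperplane, which does not contain [delta].  Therefore [delta]
    is central in [gt]; being in both Delta and [C], it is zero, a
    contradiction. *)

Section Brackets.
Variables (k : fieldType) (V : vectType k).
Implicit Types br : V -> V -> V.

Lemma bracketDl br : is_lie_bracket br ->
  forall x y z, br (x + y) z = br x z + br y z.
Proof.
by case=> linl _ _ _ x y z; have /= := linl z 1 x y; rewrite !scale1r.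
Qed.

Lemma bracketDr br : is_lie_bracket br ->
  forall x y z, br x (y + z) = br x y + br x z.
Proof.
by case=> _ linr _ _ x y z; have /= := linr x 1 y z; rewrite !scale1r.
Qed.

Lemma bracket0l br : is_lie_bracket br -> forall y, br 0 y = 0.
Proof.
by move=> Lbr y; apply: (addrI (br 0 y)); rewrite -(bracketDl Lbr) !addr0.
Qed.

Lemma bracketC br : is_lie_bracket br -> forall x y, br x y = - br y x.
Proof.
move=> Lbr x y; apply/eqP; rewrite -addr_eq0; apply/eqP.
have := lie_alt Lbr (x + y).
by rewrite (bracketDl Lbr) !(bracketDr Lbr) !(lie_alt Lbr) add0r addr0.
Qed.

Lemma bracketZr br : is_lie_bracket br ->
  forall x a y, br x (a *: y) = a *: br x y.
Proof.
move=> Lbr x a y; have := lie_linear_r Lbr x a y 0.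
by rewrite [br x 0](bracketC Lbr) (bracket0l Lbr) oppr0 !addr0.
Qed.

Lemma center_bracketl br x : is_lie_bracket br ->
  x \in lie_center br -> forall y, br x y = 0.
Proof. by move=> Lbr /(lie_centerP x Lbr). Qed.

Lemma center_bracketr br y : is_lie_bracket br ->
  y \in lie_center br -> forall x, br x y = 0.
Proof.
by move=> Lbr Zy x; rewrite (bracketC Lbr) (center_bracketl Lbr) ?oppr0.
Qed.

Lemma mem_derived br : is_lie_bracket br ->
  forall x y, br x y \in lie_derived br.
Proof. by move=> Lbr; apply/(lie_derivedP _ Lbr)/subvv. Qed.

(** Equality in [k] being decidable, testing the finitely many brackets of
    basis vectors makes this constructive. *)
Lemma nonabelian_witness br : is_lie_bracket br ->
  ~ (forall x y, br x y = 0) -> exists x y, br x y != 0.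
Proof.
move=> Lbr nab.
have [/hasP[_ /allpairsP[p [_ _ ->]] p_neq0] | /hasPn all0] := boolP (has
  (predC1 0) [seq br x y | x <- vbasis {:V}, y <- vbasis {:V}]).
  by exists p.1, p.2.
case: nab; suff /(lie_derivedP _ Lbr) D0 : (lie_derived br <= 0)%VS.
  by move=> x y; apply/eqP; rewrite -memv0.
by apply/span_subvP => v /all0; rewrite memv0 negbK.
Qed.

(** The Jacobi identity of a sum of two brackets is the sum of their two
    Jacobi identities and of this polarized one. *)
Lemma mixed_jacobi br br' x y z :
    is_lie_bracket br -> is_lie_bracket br' -> compatible br br' ->
  (br' (br x y) z + br' (br y z) x + br' (br z x) y) +
  (br (br' x y) z + br (br' y z) x + br (br' z x) y) = 0.
Proof.
move=> Lbr Lbr' /lie_jacobi/(_ x y z).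
rewrite !(bracketDl Lbr) !(bracketDl Lbr').
(* Collects the two pure cyclic sums first, each in the shape of the Jacobi
   identity that kills it. *)
rewrite [LHS](AC ((2*2)*(2*2)*(2*2))
                 ((1*5*9)*(4*8*12)*((3*7*11)*(2*6*10)))) /=.
by rewrite (lie_jacobi Lbr) (lie_jacobi Lbr') !add0r.
Qed.

(** A bracket that factors through a quotient [W] of [V] has the kernel of the
    projection in its center. *)
Lemma dim_center_ge br (W : vectType k) (p : {linear V -> W}) :
    is_lie_bracket br -> (forall x y, p x = 0 -> br x y = 0) ->
  (\dim {:V} <= \dim (lie_center br) + \dim {:W})%N.
Proof.
move=> Lbr brp; rewrite -(limg_ker_dim (linfun p) fullv) capfv.
apply: leq_add; last exact/dimvS/subvf.
apply/dimvS/subvP => x; rewrite memv_ker lfunE => /eqP px0.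
by apply/(lie_centerP x Lbr) => y; exact: brp.
Qed.

End Brackets.

Section DyonTriadon.
Variables (k : fieldType) (V : vectType k) (n : nat).
Implicit Types br : V -> V -> V.

Lemma dyon_nonabelian br : is_dyon n br -> exists x y, br x y != 0.
Proof.
case=> _ _ [b [Lb b_neq0 [f [[g fK gK] fbr]]]].
have [x [y bxy]] := nonabelian_witness Lb b_neq0.
exists (g (x, 0)), (g (y, 0)).
apply: contraNneq bxy => /(congr1 f).
by rewrite fbr !gK linear0 => -[->].
Qed.

Lemma dyon_dim_center br : is_dyon n br ->
  (n <= \dim (lie_center br) + 2)%N.
Proof.
case=> dimV Lbr [b [Lb _ [f [[g fK gK] fbr]]]].
have := @dim_center_ge _ _ br _ (fst \o f : {linear V -> 'rV[k]_2}) Lbr.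
rewrite dimV (dimvf 'rV[k]_2); apply=> x y /= fx0.
by apply: (can_inj fK); rewrite fbr linear0 /dsum_bracket fx0 (bracket0l Lb).
Qed.

Lemma triadon_dim_center br : is_triadon n br ->
  (n <= \dim (lie_center br) + 2)%N.
Proof.
case=> dimV Lbr [f [[g fK gK] fbr]].
(* The Heisenberg bracket only sees the first two of the three coordinates. *)
pose p : {linear V -> 'rV[k]_2} := @lsubmx k 1 2 1 \o (fst \o f).
have := @dim_center_ge _ _ br _ p Lbr.
rewrite dimV (dimvf 'rV[k]_2); apply=> x y px0.
have coord0 (i : 'I_2) : (f x).1 0 (lshift 1 i) = 0.
  by have /rowP/(_ i) := px0; rewrite /p /= !mxE.
apply: (can_inj fK); rewrite fbr linear0 /dsum_bracket /heisenberg_bracket.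
have -> : (f x).1 0 0 = 0 by rewrite -(coord0 0); congr (_ 0 _); apply: val_inj.
have -> : (f x).1 0 1 = 0 by rewrite -(coord0 1); congr (_ 0 _); apply: val_inj.
by rewrite !mul0r subrr scale0r.
Qed.

(** The bracket takes its values on the line of the third basis vector, on which
    both coordinates entering the bracket vanish. *)
Lemma triadon_nilpotent br x y z : is_triadon n br -> br (br x y) z = 0.
Proof.
case=> _ _ [f [[g fK gK] fbr]]; apply: (can_inj fK).
rewrite !fbr linear0 /dsum_bracket /heisenberg_bracket /= !mxE /=.
by rewrite !(mulr0, mul0r) subrr scale0r.
Qed.

(** Needed because [n - 3] is truncated: only for [3 <= n] does it measure the
    codimension of the common center. *)
Lemma triadon_dim_ge3 br : is_triadon n br -> (3 <= n)%N.
Proof.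
case=> dimV _ [f [[g fK gK] _]].
have imf : limg (linfun f) = fullv.
  by apply/vspaceP => w; rewrite memvf -(gK w) -(lfunE f) memv_img ?memvf.
have dimW : \dim {:('rV[k]_3 * 'rV[k]_(n - 3))%type} = (1 * 3 + 1 * (n - 3))%N.
  by rewrite dimvf.
have := limg_ker_dim (linfun f) fullv; rewrite imf dimV dimW; lia.
Qed.

End DyonTriadon.

Unset Implicit Arguments.

Theorem lemma6p5 (k : fieldType) (k_char0 : [pchar k] =i pred0)
    (n : nat) (V : vectType k) (dimV : \dim {:V} = n)
    (gd gt : V -> V -> V)
    (gd_dyon : is_dyon n gd) (gt_triadon : is_triadon n gt)
    (dimC12 : \dim (lie_center gd :&: lie_center gt) = (n - 3)%N)
    (Delta_C :
      (lie_derived gd :&: (lie_center gd + lie_center gt))%VS = 0%VS) :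
  incompatible gd gt.
Proof.
move=> compat.
have [[_ Lgd _] [_ Lgt _]] := (gd_dyon, gt_triadon).
set C := (lie_center gd + lie_center gt)%VS in Delta_C.
have Delta_C0 v : v \in lie_derived gd -> v \in C -> v = 0.
  by move=> Dv Cv; apply/eqP; rewrite -memv0 -Delta_C memv_cap Dv.
have Zt_C v : v \in lie_center gt -> v \in C by exact/subvP/addvSr.
have [a [b]] := dyon_nonabelian gd_dyon; set delta := gd a b => delta_neq0.
have Ddelta : delta \in lie_derived gd by exact: mem_derived.
have gt_delta_Zd z : z \in lie_center gd -> gt delta z = 0.
  move=> Zz; apply: Delta_C0; last first.
    by apply/Zt_C/(lie_centerP _ Lgt) => y; exact: triadon_nilpotent gt_triadon.
  (* As [z] is central in [gd], what remains is
     [gt delta z + (gd (gt b z) a + gd (gt z a) b) = 0]. *)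
  have := mixed_jacobi a b z Lgd Lgt compat.
  rewrite !(center_bracketr Lgd Zz) (center_bracketl Lgd Zz).
  rewrite !(bracket0l Lgt) !addr0 add0r.
  move/eqP; rewrite addr_eq0 => /eqP->.
  by rewrite rpredN rpredD ?mem_derived.
have full : (C + <[delta]>)%VS = fullv.
  have Cdelta : (C :&: <[delta]>)%VS = 0%VS.
    apply/eqP; rewrite -subv0 -Delta_C; apply/subvP => v.
    rewrite !memv_cap => /andP[-> /vlineP[c ->]].
    by rewrite memvZ.
  (* dim C + 1 >= (n - 2) + (n - 2) - (n - 3) + 1 = n *)
  apply/eqP; rewrite eqEdim subvf dimV /=.
  have := dimv_sum_cap C <[delta]>.
  rewrite Cdelta dimv0 dim_vline delta_neq0.
  have := dimv_sum_cap (lie_center gd) (lie_center gt).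
  rewrite dimC12 -/C.
  have := dyon_dim_center gd_dyon; have := triadon_dim_center gt_triadon.
  have := triadon_dim_ge3 gt_triadon; lia.
have Ztdelta : delta \in lie_center gt.
  apply/(lie_centerP _ Lgt) => y; have := memvf y.
  rewrite -full => /memv_addP[_ /memv_addP[u Zu [v Zv ->]] [_ /vlineP[c ->] ->]].
  rewrite !(bracketDr Lgt) (bracketZr Lgt) (lie_alt Lgt) scaler0.
  by rewrite gt_delta_Zd // (center_bracketr Lgt) // !addr0.
by move: delta_neq0; rewrite (Delta_C0 _ Ddelta (Zt_C _ Ztdelta)) eqxx.
Qed.
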